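(* Let $|\psi\rangle_{AB}=\frac{1}{\sqrt2}(|00\rangle+|11\rangle)\in\mathbb C^2\otimes\mathbb C^2$ and for $0\le\epsilon\le1$ let $\rho^{(\epsilon)}_{AB}=(1-\epsilon)|\psi\rangle\langle\psi|+\epsilon I_{AB}/4$. Define $\lambda(\epsilon)=\min\{\mu(\sigma_{AB}):\ \sigma_{AB}\text{ a two-qubit density matrix with }\langle\psi|\sigma_{AB}|\psi\rangle\ge 1-3\epsilon/4\}$. Then $\mu_{\mathrm{ent}}(\rho^{(\epsilon)}_{AB})=\lambda(\epsilon)$. Moreover, $\lambda(\epsilon)=0$ for $\epsilon\ge 2/3$, and for $\epsilon<2/3$ we have $1-3\epsilon/2\le\lambda(\epsilon)\le 1-\epsilon$.
   Context: For a bipartite density matrix $\rho_{AB}$ with reduced states $\rho_A,\rho_B$, the maximal correlation is $\mu(\rho_{AB})=\max |\mathrm{tr}(\rho_{AB}\, X_A\otimes Y_B^\dagger)|$ over $X_A\in\mathbf L(\mathcal H_A)$, $Y_B\in\mathbf L(\mathcal H_B)$ with $\mathrm{tr}(\rho_A X_A)=\mathrm{tr}(\rho_B Y_B)=0$ and $\mathrm{tr}(\rho_A X_AX_A^\dagger)=\mathrm{tr}(\rho_B Y_BY_B^\dagger)=1$. The maximal entanglement is $\mu_{\mathrm{ent}}(\rho_{AB})=\inf \max_i \mu(\tau^{(i)}_{AB})$, the infimum over all decompositions $\rho_{AB}=\sum_i p_i\tau^{(i)}_{AB}$ with $p_i\ge0$ and $\tau^{(i)}_{AB}$ density matrices. 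*)

(* Defs.v *)
From mathcomp Require Import all_boot all_order all_algebra.
From mathcomp Require Import complex mxtens.
From mathcomp Require Import classical_sets reals.

Set Implicit Arguments.
Unset Strict Implicit.
Unset Printing Implicit Defensive.

Import Order.TTheory GRing.Theory Num.Theory.
Local Open Scope ring_scope.
Local Open Scope classical_set_scope.

Section QInfo.
Variable R : realType.
Local Notation C := R[i].

Definition rC (x : R) : C := (x%:C)%C.

Definition cabs (z : C) : R := complex.Re `|z|.

Definition dag m n (M : 'M[C]_(m, n)) : 'M[C]_(n, m) := (map_mx Num.conj M)^T.

(* positive semidefinite: <v|A|v> >= 0 for all v (in the complex order,
   i.e. real and nonnegative) *)
Definition psd n (A : 'M[C]_n) : Prop :=
  forall v : 'cV[C]_n, 0 <= (dag v *m A *m v) 0 0.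

Definition density n (A : 'M[C]_n) : Prop := psd A /\ \tr A = 1.

Definition ptraceB dA dB (rho : 'M[C]_(dA * dB)) : 'M[C]_dA :=
  \matrix_(i, j) \sum_(k < dB) rho (mxtens_index (i, k)) (mxtens_index (j, k)).
Definition ptraceA dA dB (rho : 'M[C]_(dA * dB)) : 'M[C]_dB :=
  \matrix_(i, j) \sum_(k < dA) rho (mxtens_index (k, i)) (mxtens_index (k, j)).

Definition maxcorr_set dA dB (rho : 'M[C]_(dA * dB)) : set R :=
  [set r | exists (X : 'M[C]_dA) (Y : 'M[C]_dB),
     [/\ \tr (ptraceB rho *m X) = 0, \tr (ptraceA rho *m Y) = 0,
         \tr (ptraceB rho *m (X *m dag X)) = 1,
         \tr (ptraceA rho *m (Y *m dag Y)) = 1 &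
         r = cabs (\tr (rho *m (X *t dag Y)))]].

Definition maxcorr dA dB (rho : 'M[C]_(dA * dB)) : R := sup (maxcorr_set rho).

Definition maxent dA dB (rho : 'M[C]_(dA * dB)) : R :=
  inf [set r | exists (n : nat) (p : 'I_n -> R) (tau : 'I_n -> 'M[C]_(dA * dB)),
     [/\ forall i, 0 <= p i,
         forall i, density (tau i),
         rho = \sum_(i < n) rC (p i) *: tau i &
         r = \big[Num.max/0]_(i < n) maxcorr (tau i)]].

Definition psi : 'cV[C]_(2 * 2) :=
  \col_k (if (mxtens_unindex k).1 == (mxtens_unindex k).2 :> nat
          then rC ((Num.sqrt 2)^-1) else 0).

Definition rho_eps (eps : R) : 'M[C]_(2 * 2) :=
  rC (1 - eps) *: (psi *m dag psi) + rC (eps / 4) *: 1%:M.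

Definition lambda (eps : R) : R :=
  inf [set r | exists sigma : 'M[C]_(2 * 2),
     [/\ density sigma,
         rC (1 - 3 * eps / 4) <= (dag psi *m sigma *m psi) 0 0 &
         r = maxcorr sigma]].

End QInfo.

(* Main.v *)
From HB Require Import structures.
Require Import Defs.
From mathcomp Require Import all_boot all_order all_algebra.
From mathcomp Require Import complex mxtens.
From mathcomp Require Import classical_sets reals.
From mathcomp Require Import ring lra.

(* The form tr(rho M N^dag) is positive semidefinite, so Cauchy-Schwarz bounds
   maximal correlations by 1 and bounds a general covariance by mu times the mean
   of the two variances.  Applying this to the pairs of matrix units E_ij, E_ji,
   whose tensors sum to d |psi><psi|, and using that the purities are at most 1,
   gives d <psi|rho|psi> <= 1 + (d - 1) mu(rho); this is the lower bound on lambda.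

   For maxent = lambda: in any decomposition of rho_eps some term has fidelity at
   least 1 - 3 eps / 4.  Conversely mu is invariant under local unitaries, and
   averaging sigma over the twelve maps U (x) conj U, U in the tetrahedral group
   generated by the Pauli matrices and an order-3 Clifford element, gives an
   isotropic state with the same fidelity; mixing it with I/4, for which mu
   vanishes, gives rho_eps. *)

Set Implicit Arguments.
Unset Strict Implicit.
Unset Printing Implicit Defensive.

Import Order.TTheory GRing.Theory Num.Theory.
Local Open Scope ring_scope.

(** * The real numbers inside the complex numbers *)

Section ComplexScalars.
Variable R : realType.
Local Notation C := R[i].

(** [rC] hides the canonical embedding, so its morphism structure is registered again to make the
    [rmorph] rules apply. *)
Lemma rC_is_zmod_morphism : zmod_morphism (@rC R).
Proof. exact: (rmorphB (real_complex R)). Qed.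

Lemma rC_is_monoid_morphism : monoid_morphism (@rC R).
Proof. by split; [|exact: (rmorphM (real_complex R))]. Qed.

HB.instance Definition _ :=
  GRing.isZmodMorphism.Build R C (@rC R) rC_is_zmod_morphism.
HB.instance Definition _ :=
  GRing.isMonoidMorphism.Build R C (@rC R) rC_is_monoid_morphism.

Lemma ler_rC (x y : R) : (rC x <= rC y) = (x <= y).
Proof. exact: lecR. Qed.

Lemma rC_ge0 (x : R) : (0 <= rC x) = (0 <= x).
Proof. exact: ler0c. Qed.

Lemma rC_inj : injective (@rC R).
Proof. exact: complexI. Qed.

Lemma conj_rC (x : R) : (rC x)^* = rC x.
Proof. exact: conjc_real. Qed.

Lemma ReK (z : C) : 0 <= z -> rC (complex.Re z) = z.
Proof. by move=> z0; apply: RRe_real; rewrite ger0_real. Qed.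

Lemma rC_cabs (z : C) : rC (cabs z) = `|z|.
Proof. exact: ReK. Qed.

Lemma cabs_ge0 (z : C) : 0 <= cabs z.
Proof. by rewrite -rC_ge0 rC_cabs. Qed.

Lemma cabs_le (z : C) (x : R) : (cabs z <= x) = (`|z| <= rC x).
Proof. by rewrite -ler_rC rC_cabs. Qed.

End ComplexScalars.

(** * Adjoints, tensor products and partial traces *)

Section Adjoint.
Variable R : realType.
Local Notation C := R[i].

Lemma dagE m n (M : 'M[C]_(m, n)) i j : dag M i j = (M j i)^*.
Proof. by rewrite !mxE. Qed.

Lemma dagK m n (M : 'M[C]_(m, n)) : dag (dag M) = M.
Proof. by apply/matrixP => i j; rewrite !dagE conjCK. Qed.

Lemma dagD m n (M N : 'M[C]_(m, n)) : dag (M + N) = dag M + dag N.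
Proof. by apply/matrixP => i j; rewrite !mxE rmorphD. Qed.

Lemma dagZ m n a (M : 'M[C]_(m, n)) : dag (a *: M) = a^* *: dag M.
Proof. by apply/matrixP => i j; rewrite !mxE rmorphM. Qed.

Lemma dagM m n p (M : 'M[C]_(m, n)) (N : 'M[C]_(n, p)) :
  dag (M *m N) = dag N *m dag M.
Proof. by rewrite /dag map_mxM trmx_mul. Qed.

Lemma dag1 n : dag (1%:M : 'M[C]_n) = 1%:M.
Proof. by rewrite /dag map_mx1 trmx1. Qed.

Lemma dag_delta m n (i : 'I_m) (j : 'I_n) :
  dag (delta_mx i j : 'M[C]_(m, n)) = delta_mx j i.
Proof. by rewrite /dag map_delta_mx trmx_delta. Qed.

Lemma dag_tens m n p q (M : 'M[C]_(m, n)) (N : 'M[C]_(p, q)) :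
  dag (M *t N) = dag M *t dag N.
Proof. by apply/matrixP => i j; rewrite !mxE rmorphM. Qed.

Lemma tensmxDl m n p q (A A' : 'M[C]_(m, n)) (B : 'M[C]_(p, q)) :
  (A + A') *t B = A *t B + A' *t B.
Proof. by apply/matrixP => i j; rewrite !mxE mulrDl. Qed.

Lemma tensmxDr m n p q (A : 'M[C]_(m, n)) (B B' : 'M[C]_(p, q)) :
  A *t (B + B') = A *t B + A *t B'.
Proof. by apply/matrixP => i j; rewrite !mxE mulrDr. Qed.

Lemma tensmxZl m n p q a (A : 'M[C]_(m, n)) (B : 'M[C]_(p, q)) :
  (a *: A) *t B = a *: (A *t B).
Proof. by apply/matrixP => i j; rewrite !mxE mulrA. Qed.

Lemma tensmxZr m n p q a (A : 'M[C]_(m, n)) (B : 'M[C]_(p, q)) :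
  A *t (a *: B) = a *: (A *t B).
Proof. by apply/matrixP => i j; rewrite !mxE mulrCA. Qed.

Lemma tensmx11 m n : (1%:M *t 1%:M : 'M[C]_(m * n)) = 1%:M.
Proof.
apply/matrixP => k l; case: (mxtens_indexP k) => i j.
case: (mxtens_indexP l) => i' j'.
rewrite tensmxE !mxE (can_eq (@mxtens_indexK _ _)) xpair_eqE.
by case: eqP; case: eqP; rewrite ?mulr1 ?mul0r ?mulr0.
Qed.

Lemma sum_mxtens (V : nmodType) m n (F : 'I_(m * n) -> V) :
  \sum_k F k = \sum_i \sum_j F (mxtens_index (i, j)).
Proof.
rewrite pair_big [LHS](reindex (@mxtens_index m n)) /=.
  by apply: eq_bigr => -[].
by exists (@mxtens_unindex m n) => i _; rewrite (mxtens_indexK, mxtens_unindexK).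
Qed.

(** Duality between the partial trace and [X |-> X *t 1%:M]; it lifts the local conditions of
    [maxcorr_set] to the whole space. *)
Lemma mxtrace_ptraceB dA dB (rho : 'M[C]_(dA * dB)) X :
  \tr (ptraceB rho *m X) = \tr (rho *m (X *t 1%:M)).
Proof.
rewrite /mxtrace sum_mxtens; apply: eq_bigr => i _.
transitivity (\sum_j \sum_k
    rho (mxtens_index (i, k)) (mxtens_index (j, k)) * X j i).
  by rewrite mxE; apply: eq_bigr => j _; rewrite mxE mulr_suml.
rewrite exchange_big; apply: eq_bigr => k _; rewrite mxE sum_mxtens.
apply: eq_bigr => j _; rewrite (bigD1 k) //= tensmxE mxE eqxx mulr1.
rewrite big1 ?addr0// => l lk.
by rewrite tensmxE mxE (negPf lk) !mulr0.
Qed.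

Lemma mxtrace_ptraceA dA dB (rho : 'M[C]_(dA * dB)) Y :
  \tr (ptraceA rho *m Y) = \tr (rho *m (1%:M *t Y)).
Proof.
rewrite /mxtrace sum_mxtens exchange_big; apply: eq_bigr => i _.
transitivity (\sum_j \sum_k
    rho (mxtens_index (k, i)) (mxtens_index (k, j)) * Y j i).
  by rewrite mxE; apply: eq_bigr => j _; rewrite mxE mulr_suml.
rewrite exchange_big; apply: eq_bigr => k _; rewrite mxE sum_mxtens.
rewrite (bigD1 k) //= [X in _ + X]big1 ?addr0.
  by apply: eq_bigr => j _; rewrite tensmxE mxE eqxx mul1r.
move=> l lk; apply: big1 => j _.
by rewrite tensmxE mxE (negPf lk) mul0r mulr0.
Qed.

End Adjoint.

(** * Positive semidefinite sesquilinear forms *)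

Section PositiveForm.
Variables (K : numClosedFieldType) (V : lmodType K) (B : V -> V -> K).
Hypotheses (BDl : forall x x' y, B (x + x') y = B x y + B x' y)
  (BDr : forall x y y', B x (y + y') = B x y + B x y')
  (BZl : forall a x y, B (a *: x) y = a * B x y)
  (BZr : forall a x y, B x (a *: y) = a^* * B x y)
  (B_ge0 : forall x, 0 <= B x x).

(** Polarization: [B z z] is real at [x + y] and at [x + 'i *: y], which gives [e1] and [e2]; their
    sum is twice the claim. *)
Lemma form_conj x y : B y x = (B x y)^*.
Proof.
have r0 z : (B z z)^* = B z z by rewrite conj_Creal ?ger0_real.
have h1 := r0 (x + y); have h2 := r0 (x + 'i *: y).
rewrite !(BDl, BDr, BZl, BZr) !rmorphD /= !r0 in h1.
rewrite !(BDl, BDr, BZl, BZr) !rmorphD !rmorphM /= !r0 in h2.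
rewrite conjCi rmorphN /= conjCi in h2.
move: h1 h2; set u := B x y; set v := B y x.
set a := B x x; set b := B y y => h1 h2.
have e1 : u^* + v^* = u + v.
  transitivity (a + u^* + (v^* + b) - a - b); first by ring.
  by rewrite h1; ring.
have e2 : u^* - v^* = v - u.
  apply: (mulfI (neq0Ci K)).
  transitivity (a + - - 'i * u^* + (- 'i * v^* + - 'i * (- - 'i * b))
    - a + 'i * 'i * b); first by ring.
  by rewrite h2; ring.
apply: (@mulfI _ 2); first by rewrite pnatr_eq0.
transitivity (u + v + (v - u)); first by ring.
by rewrite -e1 -e2; ring.
Qed.

Lemma form_CauchySchwarz x y : `|B x y| ^+ 2 <= B x x * B y y.
Proof.
have key z : 0 <= B x x - z^* * B x y - z * (B x y)^* + `|z| ^+ 2 * B y y.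
  have := B_ge0 (x + - z *: y).
  rewrite !(BDl, BDr, BZl, BZr) (form_conj x y) rmorphN /= normCK.
  by congr (0 <= _); ring.
have a0 := B_ge0 x; have b0 := B_ge0 y.
move: key a0 b0; set a := B x x; set b := B y y; set c := B x y => key a0 b0.
have cc : c * c^* = `|c| ^+ 2 by rewrite normCK.
have [bE|bN0] := eqVneq b 0.
  rewrite bE mulr0; have [->|cN0] := eqVneq c 0; first by rewrite normr0 expr0n.
  have cJ : c^* != 0 by rewrite conjC_eq0.
  (* With [b = 0], this [z] makes both cross terms equal to [a + 1] and leaves the negative value
     [- a - 2]. *)
  have := key ((a + 1) / c^*); rewrite bE.
  rewrite rmorphM fmorphV rmorphD rmorph1 /= conjCK (conj_Creal (ger0_real a0)).
  set w := (X in 0 <= X); have -> : w = - a - 2.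
    by rewrite /w; field; apply/andP.
  rewrite -opprD oppr_ge0 => h; have : 0 < a + 2 by rewrite ltr_wpDl.
  by move/lt_le_trans => /(_ _ h); rewrite ltxx.
(* The optimal [z]: the coefficient of the orthogonal projection of [x] on [y]. *)
have := key (c / b).
rewrite normf_div rmorphM fmorphV /= (conj_Creal (ger0_real b0)) (ger0_norm b0).
rewrite exprMn exprVn normCK.
set w := (X in 0 <= X); have -> : w = (a * b - c * c^*) / b.
  by rewrite /w; field.
by rewrite pmulr_lge0 ?subr_ge0// invr_gt0 lt_neqAle eq_sym bN0.
Qed.

Lemma sqrtC_normalize (a : K) : 0 <= a -> a != 0 ->
  (sqrtC a)^-1 * ((sqrtC a)^-1^* * a) = 1.
Proof.
move=> a0 aN0; rewrite fmorphV /= conj_Creal ?ger0_real ?sqrtC_ge0//.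
by rewrite mulrA -invfM -expr2 sqrtCK mulVf.
Qed.

(** Normalising both vectors gives the bound with the geometric mean of [B x x] and [B y y]; the
    arithmetic mean is larger and can later be summed termwise. If one of them vanishes,
    Cauchy-Schwarz gives [B x y = 0]. *)
Lemma form_le_amgm (m : K) x y : 0 <= m ->
  (forall s t, B (s *: x) (s *: x) = 1 -> B (t *: y) (t *: y) = 1 ->
     `|B (s *: x) (t *: y)| <= m) ->
  `|B x y| <= m * ((B x x + B y y) / 2).
Proof.
move=> m0 le_m; have a0 := B_ge0 x; have b0 := B_ge0 y.
have [ab0|] := eqVneq (B x x * B y y) 0.
  have := form_CauchySchwarz x y; rewrite ab0 => CS.
  have -> : `|B x y| = 0.
    by apply/eqP; rewrite -sqrf_eq0 eq_le CS exprn_ge0.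
  by rewrite mulr_ge0// divr_ge0// addr_ge0.
rewrite mulf_eq0 negb_or => /andP[aN0 bN0].
have := le_m (sqrtC (B x x))^-1 (sqrtC (B y y))^-1.
rewrite !(BZl, BZr) => /(_ (sqrtC_normalize a0 aN0) (sqrtC_normalize b0 bN0)).
move: a0 b0 aN0 bN0; set a := B x x; set b := B y y => a0 b0 aN0 bN0.
have sa : 0 < sqrtC a by rewrite sqrtC_gt0 lt_neqAle eq_sym aN0.
have sb : 0 < sqrtC b by rewrite sqrtC_gt0 lt_neqAle eq_sym bN0.
rewrite !normrM norm_conjC !normfV (gtr0_norm sa) (gtr0_norm sb).
rewrite mulrA -invfM mulrC ler_pdivrMr ?mulr_gt0// => /le_trans; apply.
apply: ler_wpM2l => //; rewrite ler_pdivlMr // -subr_ge0.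
have -> : a + b - sqrtC a * sqrtC b * 2 = (sqrtC a - sqrtC b) ^+ 2.
  by rewrite -[X in X + _ - _]sqrtCK -[X in _ + X - _]sqrtCK; ring.
by rewrite real_exprn_even_ge0// rpredB// gtr0_real.
Qed.

(** Removing the components along the unit vector [e] turns values of [B] into covariances. The
    bound [m] is assumed only on multiples of the two centred vectors, because in the application it
    holds only for local operators. *)
Lemma form_covariance_le (m : K) e x y : B e e = 1 -> 0 <= m ->
  (forall s t,
     let x' := s *: (x - B x e *: e) in let y' := t *: (y - B y e *: e) in
     B x' e = 0 -> B y' e = 0 -> B x' x' = 1 -> B y' y' = 1 -> `|B x' y'| <= m) ->
  `|B x y - B x e * (B y e)^*| <=
    m * ((B x x - `|B x e| ^+ 2 + (B y y - `|B y e| ^+ 2)) / 2).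
Proof.
move=> e1 m0 le_m.
have cov z w : B (z - B z e *: e) (w - B w e *: e) = B z w - B z e * (B w e)^*.
  rewrite -!scaleNr !(BDl, BDr, BZl, BZr) e1 (form_conj w e) rmorphN /=; ring.
have cen s z : B (s *: (z - B z e *: e)) e = 0.
  by rewrite -scaleNr !(BDl, BZl) e1 mulr1 subrr mulr0.
rewrite !normCK -!cov; apply: form_le_amgm => // s t hx hy.
exact: le_m (cen _ _) (cen _ _) hx hy.
Qed.

End PositiveForm.

(** * The trace form weighted by a state *)

Section Form.
Variables (R : realType) (n : nat) (rho : 'M[R[i]]_n).
Local Notation C := R[i].

(** [hsp M 1%:M] is the mean of [M] in the state [rho], and [hsp M M] the second moment that
    [maxcorr_set] normalises. *)
Definition hsp (M N : 'M[C]_n) : C := \tr (rho *m (M *m dag N)).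

Lemma hspDl M M' N : hsp (M + M') N = hsp M N + hsp M' N.
Proof. by rewrite /hsp mulmxDl mulmxDr mxtraceD. Qed.

Lemma hspDr M N N' : hsp M (N + N') = hsp M N + hsp M N'.
Proof. by rewrite /hsp dagD !mulmxDr mxtraceD. Qed.

Lemma hspZl a M N : hsp (a *: M) N = a * hsp M N.
Proof. by rewrite /hsp -scalemxAl -scalemxAr mxtraceZ. Qed.

Lemma hspZr a M N : hsp M (a *: N) = a^* * hsp M N.
Proof. by rewrite /hsp dagZ -!scalemxAr mxtraceZ. Qed.

Hypothesis rho_psd : psd rho.

(** By cyclicity this is the trace of [dag M *m rho *m M], whose diagonal entries are the values of
    the quadratic form of [rho] at the columns of [M]. *)
Lemma hsp_ge0 M : 0 <= hsp M M.
Proof.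
rewrite /hsp mulmxA mxtrace_mulC; apply: sumr_ge0 => k _.
suff -> : (dag M *m (rho *m M)) k k =
          (dag (col k M) *m rho *m col k M) 0 0 by exact: rho_psd.
rewrite -mulmxA !mxE; apply: eq_bigr => j _; rewrite !mxE; congr (_ * _).
by apply: eq_bigr => l _; rewrite !mxE.
Qed.

Lemma hsp_CauchySchwarz M N : `|hsp M N| ^+ 2 <= hsp M M * hsp N N.
Proof. exact: (form_CauchySchwarz hspDl hspDr hspZl hspZr hsp_ge0). Qed.

End Form.

(** * Maximal correlation and covariances of local operators *)

Section MaximalCorrelation.
Variables (R : realType) (dA dB : nat) (rho : 'M[R[i]]_(dA * dB)).
Local Notation C := R[i].
Local Notation lA X := (X *t (1%:M : 'M[C]_dB)).
Local Notation lB Y := ((1%:M : 'M[C]_dA) *t Y).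

Lemma hsp_tens X Y : \tr (rho *m (X *t dag Y)) = hsp rho (lA X) (lB Y).
Proof. by rewrite /hsp dag_tens dag1 tensmx_mul mulmx1 mul1mx. Qed.

Lemma hsp_lA X X' : hsp rho (lA X) (lA X') = \tr (ptraceB rho *m (X *m dag X')).
Proof. by rewrite mxtrace_ptraceB /hsp dag_tens dag1 tensmx_mul mulmx1. Qed.

Lemma hsp_lB Y Y' : hsp rho (lB Y) (lB Y') = \tr (ptraceA rho *m (Y *m dag Y')).
Proof. by rewrite mxtrace_ptraceA /hsp dag_tens dag1 tensmx_mul mulmx1. Qed.

Lemma hsp_lA1 X : hsp rho (lA X) 1%:M = \tr (ptraceB rho *m X).
Proof. by rewrite -(tensmx11 R dA dB) hsp_lA dag1 mulmx1. Qed.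

Lemma hsp_lB1 Y : hsp rho (lB Y) 1%:M = \tr (ptraceA rho *m Y).
Proof. by rewrite -(tensmx11 R dA dB) hsp_lB dag1 mulmx1. Qed.

(** Expresses means, variances and correlation through the single form [hsp rho], so that the
    results on positive forms apply. *)
Lemma maxcorr_setE (r : R) : maxcorr_set rho r <->
  exists X Y, [/\ hsp rho (lA X) 1%:M = 0, hsp rho (lB Y) 1%:M = 0,
    hsp rho (lA X) (lA X) = 1, hsp rho (lB Y) (lB Y) = 1 &
    r = cabs (hsp rho (lA X) (lB Y))].
Proof.
by split=> -[X] [Y] h; exists X, Y; move: h;
  rewrite hsp_lA1 hsp_lB1 hsp_lA hsp_lB hsp_tens.
Qed.

Lemma maxcorr_le (m : R) : 0 <= m ->
  (forall X Y, hsp rho (lA X) 1%:M = 0 -> hsp rho (lB Y) 1%:M = 0 ->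
     hsp rho (lA X) (lA X) = 1 -> hsp rho (lB Y) (lB Y) = 1 ->
     cabs (hsp rho (lA X) (lB Y)) <= m) ->
  maxcorr rho <= m.
Proof.
move=> m0 le_m; rewrite /maxcorr.
(* No pair is admissible if, for instance, a factor has dimension 1; [sup] is then 0, whence the
   hypothesis [0 <= m]. *)
have [->|/set0P E0] := eqVneq (maxcorr_set rho) set0; first by rewrite sup0.
by apply: ge_sup => // r /maxcorr_setE[X] [Y] [hX hY vX vY ->]; exact: le_m.
Qed.

Hypothesis rho_psd : psd rho.

Lemma maxcorr_set_ub : ubound (maxcorr_set rho) 1.
Proof.
move=> r /maxcorr_setE[X] [Y] [_ _ vX vY ->]; rewrite cabs_le rmorph1.
have := hsp_CauchySchwarz rho_psd (lA X) (lB Y).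
by rewrite vX vY mulr1 expr_le1.
Qed.

Lemma maxcorr_ub X Y : hsp rho (lA X) 1%:M = 0 -> hsp rho (lB Y) 1%:M = 0 ->
  hsp rho (lA X) (lA X) = 1 -> hsp rho (lB Y) (lB Y) = 1 ->
  `|hsp rho (lA X) (lB Y)| <= rC (maxcorr rho).
Proof.
move=> hX hY vX vY; rewrite -cabs_le; apply: ub_le_sup.
  by exists 1; exact: maxcorr_set_ub.
by apply/maxcorr_setE; exists X, Y.
Qed.

Lemma maxcorr_ge0 : 0 <= maxcorr rho.
Proof.
rewrite /maxcorr.
have [->|/set0P[r Er]] := eqVneq (maxcorr_set rho) set0; first by rewrite sup0.
apply: (@le_trans _ _ r).
  by have [X [Y [_ _ _ _ ->]]] := Er; exact: cabs_ge0.
by apply: ub_le_sup => //; exists 1; exact: maxcorr_set_ub.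
Qed.

Lemma maxcorr_le1 : maxcorr rho <= 1.
Proof.
apply: maxcorr_le => // X Y hX hY vX vY; apply: maxcorr_set_ub.
by apply/maxcorr_setE; exists X, Y.
Qed.

Hypothesis rho_tr1 : \tr rho = 1.

Lemma covariance_le X Y :
  `|hsp rho (lA X) (lB Y) - hsp rho (lA X) 1%:M * (hsp rho (lB Y) 1%:M)^*| <=
    rC (maxcorr rho) *
      ((hsp rho (lA X) (lA X) - `|hsp rho (lA X) 1%:M| ^+ 2 +
        (hsp rho (lB Y) (lB Y) - `|hsp rho (lB Y) 1%:M| ^+ 2)) / 2).
Proof.
set a := hsp rho (lA X) 1%:M; set b := hsp rho (lB Y) 1%:M.
have h11 : hsp rho 1%:M 1%:M = 1 by rewrite /hsp dag1 !mulmx1.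
(* Centring and rescaling keep an operator local, so [maxcorr_ub] applies to the result. *)
have eA s : s *: (lA X - a *: 1%:M) = lA (s *: (X - a *: 1%:M)).
  by rewrite tensmxZl -!scaleNr tensmxDl tensmxZl tensmx11.
have eB s : s *: (lB Y - b *: 1%:M) = lB (s *: (Y - b *: 1%:M)).
  by rewrite tensmxZr -!scaleNr tensmxDr tensmxZr tensmx11.
have := form_covariance_le (@hspDl R _ rho) (@hspDr R _ rho) (@hspZl R _ rho)
  (@hspZr R _ rho) (hsp_ge0 rho_psd) h11.
apply; first by rewrite rC_ge0; exact: maxcorr_ge0.
by move=> s t; rewrite eA eB; exact: maxcorr_ub.
Qed.

End MaximalCorrelation.

(** * Lower bound on the maximal correlation by the fidelity *)

(** [A] and [B] stand for the reduced states. Bounding the product of means by half the sum of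
    squares leaves the squares with weight [(1 - m) / 2 >= 0] and the diagonal entries with weight
    [m / 2]. Over all [i, j] the squares sum to at most 1 for each of [A] and [B], the diagonal
    entries to [d]. *)
Lemma correlation_sum_le (K : numClosedFieldType) d (A B : 'M[K]_d)
    (T : 'I_d -> 'I_d -> K) (m : K) :
  (forall i j, `|A i j| ^+ 2 <= A i i * A j j) -> \tr A = 1 ->
  (forall i j, `|B i j| ^+ 2 <= B i i * B j j) -> \tr B = 1 ->
  0 <= m -> m <= 1 ->
  (forall i j, `|T i j - A j i * (B i j)^*| <=
     m * ((A i i - `|A j i| ^+ 2 + (B j j - `|B i j| ^+ 2)) / 2)) ->
  `|\sum_i \sum_j T i j| <= 1 + (d%:R - 1) * m.
Proof.
move=> leA trA leB trB m0 m1 leT.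
have two0 : (2 : K) != 0 by rewrite pnatr_eq0.
have le1 i j : `|T i j| <= (1 - m) / 2 * (A j j * A i i + B i i * B j j) +
                           m / 2 * (A i i + B j j).
  rewrite -[T i j](subrK (A j i * (B i j)^*)).
  apply: (le_trans (ler_normD _ _)).
  apply: (@le_trans _ _
    ((1 - m) / 2 * (`|A j i| ^+ 2 + `|B i j| ^+ 2) + m / 2 * (A i i + B j j))).
    have am : `|A j i * (B i j)^*| <= (`|A j i| ^+ 2 + `|B i j| ^+ 2) / 2.
      rewrite normrM norm_conjC ler_pdivlMr // -subr_ge0.
      have -> : `|A j i| ^+ 2 + `|B i j| ^+ 2 - `|A j i| * `|B i j| * 2 =
                (`|A j i| - `|B i j|) ^+ 2 by ring.
      by rewrite real_exprn_even_ge0// rpredB// normr_real.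
    apply: le_trans (lerD (leT i j) am) _.
    by rewrite le_eqVlt; apply/orP; left; apply/eqP; field.
  by rewrite lerD2r ler_wpM2l ?lerD// divr_ge0 ?subr_ge0.
have sum1 (M N : 'M[K]_d) : \tr M = 1 -> \tr N = 1 ->
    \sum_i \sum_j M i i * N j j = 1.
  move=> trM trN; rewrite -[RHS]mulr1 -[X in X * _]trM -[X in _ * X]trN.
  by rewrite mulr_suml; apply: eq_bigr => i _; rewrite mulr_sumr.
have sumd (M : 'M[K]_d) : \tr M = 1 -> \sum_i \sum_(j < d) M i i = d%:R.
  move=> trM; under eq_bigr do rewrite sumr_const card_ord.
  by rewrite sumrMnl -/(\tr M) trM.
have sumd' (M : 'M[K]_d) : \tr M = 1 -> \sum_(i < d) \sum_j M j j = d%:R.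
  by move=> trM; rewrite exchange_big sumd.
apply: (le_trans (ler_norm_sum _ _ _)).
apply: (@le_trans _ _ (\sum_i \sum_j ((1 - m) / 2 *
   (A j j * A i i + B i i * B j j) + m / 2 * (A i i + B j j)))).
  apply: ler_sum => i _; apply: (le_trans (ler_norm_sum _ _ _)).
  by apply: ler_sum => j _; exact: le1.
under eq_bigr do rewrite big_split -!mulr_sumr /= !big_split /=.
rewrite big_split -!mulr_sumr /= !big_split /=.
rewrite exchange_big sum1// sum1// sumd// sumd'//.
by rewrite le_eqVlt; apply/orP; left; apply/eqP; field.
Qed.

Section Fidelity.
Variable R : realType.
Local Notation C := R[i].

Lemma mxtrace_mul_delta n (M : 'M[C]_n) i j : \tr (M *m delta_mx i j) = M j i.
Proof.
rewrite /mxtrace (bigD1 j) //= big1 ?addr0 => [|k kj].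
  rewrite mxE (bigD1 i) //= big1 ?addr0 => [|l li].
    by rewrite mxE !eqxx mulr1.
  by rewrite mxE (negPf li) mulr0.
by rewrite mxE big1// => l _; rewrite mxE (negPf kj) andbF mulr0.
Qed.

Lemma tensmx_delta m n p q (i : 'I_m) (j : 'I_n) (k : 'I_p) (l : 'I_q) :
  delta_mx i j *t delta_mx k l =
  delta_mx (mxtens_index (i, k)) (mxtens_index (j, l)) :> 'M[C]_(m * p, n * q).
Proof.
apply/matrixP => a b; case: (mxtens_indexP a) => i' k'.
case: (mxtens_indexP b) => j' l'; rewrite tensmxE !mxE.
rewrite !(can_eq (@mxtens_indexK _ _)) !xpair_eqE -natrM mulnb.
by rewrite andbACA.
Qed.

(** The form takes the matrix units [delta_mx j j] and [delta_mx i j] to the entry [i j] of the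
    reduced state, and their norms to its diagonal entries. *)
Lemma ptraceB_CauchySchwarz dA dB (rho : 'M[C]_(dA * dB)) : psd rho ->
  forall i j, `|ptraceB rho i j| ^+ 2 <= ptraceB rho i i * ptraceB rho j j.
Proof.
move=> psd_rho i j.
have := hsp_CauchySchwarz psd_rho (delta_mx j j *t 1%:M) (delta_mx i j *t 1%:M).
by rewrite !hsp_lA !dag_delta !mul_delta_mx !mxtrace_mul_delta mulrC.
Qed.

Lemma ptraceA_CauchySchwarz dA dB (rho : 'M[C]_(dA * dB)) : psd rho ->
  forall i j, `|ptraceA rho i j| ^+ 2 <= ptraceA rho i i * ptraceA rho j j.
Proof.
move=> psd_rho i j.
have := hsp_CauchySchwarz psd_rho (1%:M *t delta_mx j j) (1%:M *t delta_mx i j).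
by rewrite !hsp_lB !dag_delta !mul_delta_mx !mxtrace_mul_delta mulrC.
Qed.

Lemma mxtrace_ptraceB1 dA dB (rho : 'M[C]_(dA * dB)) :
  \tr (ptraceB rho) = \tr rho.
Proof. by rewrite -[ptraceB rho]mulmx1 mxtrace_ptraceB tensmx11 mulmx1. Qed.

Lemma mxtrace_ptraceA1 dA dB (rho : 'M[C]_(dA * dB)) :
  \tr (ptraceA rho) = \tr rho.
Proof. by rewrite -[ptraceA rho]mulmx1 mxtrace_ptraceA tensmx11 mulmx1. Qed.

(** The double sum is [d] times the fidelity with the maximally entangled state of dimension [d]. *)
Lemma fidelity_sum_le d (rho : 'M[C]_(d * d)) : density rho ->
  `|\sum_i \sum_j rho (mxtens_index (j, j)) (mxtens_index (i, i))| <=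
    1 + (d%:R - 1) * rC (maxcorr rho).
Proof.
move=> [psd_rho tr_rho].
apply: (correlation_sum_le (ptraceB_CauchySchwarz psd_rho) _
  (ptraceA_CauchySchwarz psd_rho)).
- by rewrite mxtrace_ptraceB1.
- by rewrite mxtrace_ptraceA1.
- by rewrite rC_ge0; exact: maxcorr_ge0.
- by have := maxcorr_le1 psd_rho; rewrite -ler_rC rmorph1.
(* The adjoint of [delta_mx j i] is [delta_mx i j], so the correlation of this pair is a single
   entry of [rho], as are the means and second moments in the reduced states. *)
move=> i j; have := covariance_le psd_rho tr_rho (delta_mx i j) (delta_mx j i).
rewrite !hsp_lA1 !hsp_lB1 hsp_lA hsp_lB -hsp_tens !dag_delta !mul_delta_mx.
by rewrite tensmx_delta !mxtrace_mul_delta.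
Qed.

Lemma psiE i j :
  psi R (mxtens_index (i, j)) 0 = (i == j)%:R * rC ((Num.sqrt 2)^-1).
Proof.
by rewrite mxE mxtens_indexK /=; case: eqP => [/val_inj ->|] /=;
  [rewrite eqxx mul1r | case: eqP => [->//|_ _]; rewrite mul0r].
Qed.

Lemma rC_sqrt2V : rC ((Num.sqrt 2)^-1) * rC ((Num.sqrt 2)^-1) = 2^-1 :> C.
Proof. by rewrite -rmorphM -invfM -expr2 sqr_sqrtr// fmorphV rmorph_nat. Qed.

Lemma fidelityE (rho : 'M[C]_(2 * 2)) : (dag (psi R) *m rho *m psi R) 0 0 =
  2^-1 * \sum_i \sum_j rho (mxtens_index (j, j)) (mxtens_index (i, i)).
Proof.
have psi_sum (F : 'I_(2 * 2) -> C) :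
    \sum_k F k * psi R k 0 = rC ((Num.sqrt 2)^-1) * \sum_i F (mxtens_index (i, i)).
  rewrite sum_mxtens mulr_sumr; apply: eq_bigr => i _.
  rewrite (bigD1 i) //= big1 => [|j ji]; rewrite psiE.
    by rewrite eqxx mul1r addr0 mulrC.
  by rewrite eq_sym (negPf ji) mul0r mulr0.
rewrite mxE psi_sum -rC_sqrt2V -mulrA; congr (_ * _).
rewrite mulr_sumr; apply: eq_bigr => i _; rewrite mxE -(psi_sum (rho^~ _)).
apply: eq_bigr => k _; rewrite dagE mulrC; congr (_ * _).
by case: (mxtens_indexP k) => a b; rewrite psiE rmorphM /= conj_rC rmorph_nat.
Qed.

Lemma maxcorr_ge_fidelity (sigma : 'M[C]_(2 * 2)) (f : R) : density sigma ->
  rC f <= (dag (psi R) *m sigma *m psi R) 0 0 -> 2 * f - 1 <= maxcorr sigma.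
Proof.
move=> dens_sigma; rewrite fidelityE => le_f.
have fS : rC (2 * f) <= \sum_i \sum_j
    sigma (mxtens_index (j, j)) (mxtens_index (i, i)).
  move: le_f; rewrite mulrC ler_pdivlMr ?ltr0n//.
  by rewrite rmorphM rmorph_nat mulrC.
have := fidelity_sum_le dens_sigma; rewrite addrK mul1r => S_le.
rewrite -ler_rC rmorphB rmorph1 lerBlDl.
(* The sum is comparable to a real number, hence real and at most its modulus. *)
apply: le_trans S_le; apply: (le_trans fS); apply: real_ler_norm.
by rewrite (ger_real fS) CrealE conj_rC.
Qed.

End Fidelity.

(** * Closure properties of positive semidefinite matrices *)

Section Psd.
Variable R : realType.
Local Notation C := R[i].

Lemma psdD n (A B : 'M[C]_n) : psd A -> psd B -> psd (A + B).
Proof. by move=> pA pB v; rewrite mulmxDr mulmxDl mxE addr_ge0. Qed.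

Lemma psdZ n (c : R) (A : 'M[C]_n) : 0 <= c -> psd A -> psd (rC c *: A).
Proof.
by move=> c0 pA v; rewrite -scalemxAr -scalemxAl mxE mulr_ge0 ?rC_ge0.
Qed.

Lemma psd_conj m n (W : 'M[C]_(m, n)) (A : 'M[C]_n) :
  psd A -> psd (W *m A *m dag W).
Proof. by move=> pA v; have := pA (dag W *m v); rewrite dagM dagK !mulmxA. Qed.

Lemma psd1 n : psd (1%:M : 'M[C]_n).
Proof.
move=> v; rewrite mulmx1 mxE sumr_ge0// => k _.
by rewrite dagE mulrC mul_conjC_ge0.
Qed.

Lemma psd_outer n (v : 'cV[C]_n) : psd (v *m dag v).
Proof. by rewrite -[v in v *m _]mulmx1; apply: psd_conj; exact: psd1. Qed.

End Psd.

(** * Local unitaries and product states *)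

Lemma mxtrace_tens (R : realType) m n (A : 'M[R[i]]_m) (B : 'M[R[i]]_n) :
  \tr (A *t B) = \tr A * \tr B.
Proof.
rewrite [LHS]sum_mxtens mulr_suml; apply: eq_bigr => i _.
by rewrite mulr_sumr; apply: eq_bigr => j _; rewrite tensmxE.
Qed.

Section LocalUnitary.
Variables (R : realType) (dA dB : nat).
Local Notation C := R[i].
Implicit Types (rho : 'M[C]_(dA * dB)) (U : 'M[C]_dA) (V : 'M[C]_dB).

Definition local_conj U V rho := (U *t V) *m rho *m dag (U *t V).

Lemma dag_mul_tens U V : dag U *m U = 1%:M -> dag V *m V = 1%:M ->
  dag (U *t V) *m (U *t V) = 1%:M.
Proof. by move=> hU hV; rewrite dag_tens tensmx_mul hU hV tensmx11. Qed.

Lemma density_local_conj U V rho : dag U *m U = 1%:M -> dag V *m V = 1%:M ->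
  density rho -> density (local_conj U V rho).
Proof.
move=> hU hV [p t]; split; first exact: psd_conj.
by rewrite mxtrace_mulC mulmxA dag_mul_tens// mul1mx.
Qed.

Lemma hsp_local_conj U V rho M N : dag U *m U = 1%:M -> dag V *m V = 1%:M ->
  let W := U *t V in
  hsp (local_conj U V rho) M N = hsp rho (dag W *m M *m W) (dag W *m N *m W).
Proof.
move=> hU hV W; have hW : W *m dag W = 1%:M by rewrite mulmx1C// dag_mul_tens.
rewrite /hsp !dagM dagK -!mulmxA [W *m (dag W *m _)]mulmxA hW mul1mx.
by rewrite mxtrace_mulC !mulmxA.
Qed.

(** An admissible pair [X, Y] for the rotated state pulls back to [dag U *m X *m U] and
    [dag V *m Y *m V], admissible for [rho] with the same correlation. *)
Lemma maxcorr_local_conj_le U V rho : psd rho ->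
  dag U *m U = 1%:M -> dag V *m V = 1%:M ->
  maxcorr (local_conj U V rho) <= maxcorr rho.
Proof.
move=> p hU hV; apply: maxcorr_le; first exact: maxcorr_ge0.
have W1 : dag (U *t V) *m 1%:M *m (U *t V) = 1%:M.
  by rewrite mulmx1 dag_mul_tens.
have WA X : dag (U *t V) *m (X *t 1%:M) *m (U *t V) = (dag U *m X *m U) *t 1%:M.
  by rewrite dag_tens !tensmx_mul mulmx1 hV.
have WB Y : dag (U *t V) *m (1%:M *t Y) *m (U *t V) = 1%:M *t (dag V *m Y *m V).
  by rewrite dag_tens !tensmx_mul mulmx1 hU.
move=> X Y; rewrite !hsp_local_conj// W1 WA WB => hX hY vX vY.
by rewrite cabs_le; exact: (maxcorr_ub p hX hY vX vY).
Qed.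

(** The correlation factors into two traces, and the first one is the mean of [X], which is 0. *)
Lemma maxcorr_product (A : 'M[C]_dA) (B : 'M[C]_dB) : psd (A *t B) ->
  \tr B = 1 -> maxcorr (A *t B) = 0.
Proof.
move=> p trB; apply: le_anti; rewrite maxcorr_ge0// andbT.
apply: maxcorr_le => // X Y + _ _ _.
rewrite -hsp_tens hsp_lA1 mxtrace_ptraceB !tensmx_mul !mxtrace_tens mulmx1 trB mulr1.
by move=> ->; rewrite mul0r cabs_le normr0 rmorph0.
Qed.

End LocalUnitary.

(** * The cone of matrices decomposable into weakly correlated states *)

Section Decomposition.
Variables (R : realType) (dA dB : nat) (m : R).
Local Notation C := R[i].
Implicit Types rho : 'M[C]_(dA * dB).

(** The weights are not normalised, which makes this a convex cone; a matrix of trace 1 forces them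
    to sum to 1. *)
Definition decomposable rho := exists n (p : 'I_n -> R)
    (tau : 'I_n -> 'M[C]_(dA * dB)),
  [/\ forall i, 0 <= p i, forall i, density (tau i),
      forall i, maxcorr (tau i) <= m & rho = \sum_i rC (p i) *: tau i].

Lemma decomposable_density rho : density rho -> maxcorr rho <= m ->
  decomposable rho.
Proof.
move=> d le_m; exists 1%N, (fun=> 1), (fun=> rho); split => //.
by rewrite big_ord1 rmorph1 scale1r.
Qed.

Lemma decomposableD rho rho' : decomposable rho -> decomposable rho' ->
  decomposable (rho + rho').
Proof.
move=> [n [p [tau [p0 d le_m ->]]]] [n' [p' [tau' [p'0 d' le_m' ->]]]].
exists (n + n')%N, (fun i => match split i with inl j => p j | inr j => p' j end),
  (fun i => match split i with inl j => tau j | inr j => tau' j end).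
split; try by move=> i; case: split.
rewrite big_split_ord; congr (_ + _); apply: eq_bigr => i _.
  by rewrite (unsplitK (inl i)).
by rewrite (unsplitK (inr i)).
Qed.

Lemma decomposableZ (c : R) rho : 0 <= c -> decomposable rho ->
  decomposable (rC c *: rho).
Proof.
move=> c0 [n [p [tau [p0 d le_m ->]]]]; exists n, (fun i => c * p i), tau.
split=> // [i|]; first exact: mulr_ge0.
by rewrite scaler_sumr; apply: eq_bigr => i _; rewrite scalerA rmorphM.
Qed.

Lemma decomposable_local_conj (U : 'M[C]_dA) (V : 'M[C]_dB) rho :
  dag U *m U = 1%:M -> dag V *m V = 1%:M ->
  decomposable rho -> decomposable (local_conj U V rho).
Proof.
move=> hU hV [n [p [tau [p0 d le_m ->]]]].
exists n, p, (fun i => local_conj U V (tau i)); split=> // [i|i|].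
- exact: density_local_conj.
- by apply: le_trans (le_m i); apply: maxcorr_local_conj_le => //; case: (d i).
rewrite /local_conj mulmx_sumr mulmx_suml; apply: eq_bigr => i _.
by rewrite -scalemxAr -scalemxAl.
Qed.

Lemma maxent_le rho : 0 <= m -> decomposable rho -> maxent rho <= m.
Proof.
move=> m0 [n [p [tau [p0 d le_m rhoE]]]].
apply: (@le_trans _ _ (\big[Num.max/0]_(i < n) maxcorr (tau i)));
  last exact: bigmax_le.
apply: ge_inf; last by exists n, p, tau.
(* Being below [inf] requires a lower bound of the set: every maximum starts from 0. *)
by exists 0 => r [k [q [s [_ _ _ ->]]]]; exact: bigmax_ge_id.
Qed.

End Decomposition.

(** * The Bell basis and the twirl by the tetrahedral group *)

Section QubitMatrices.
Variable K : numClosedFieldType.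
Implicit Types (M N : 'M[K]_2) (sigma : 'M[K]_(2 * 2)).
(* At [K := R[i]], [adj] is convertible to [dag]. *)
Local Notation adj M := ((map_mx Num.conj M)^T).

Definition mx2 (a b c d : K) : 'M[K]_2 := \matrix_(i, j)
  if i == 0 then if j == 0 then a else b else if j == 0 then c else d.

Lemma sum2 (F : 'I_2 -> K) : \sum_i F i = F 0 + F 1.
Proof. by rewrite big_ord_recl big_ord1; congr (_ + F _); apply: val_inj. Qed.

Lemma ord2P (i : 'I_2) : {i = 0} + {i = 1}.
Proof. by case: i => -[|[|//]] ?; [left|right]; apply: val_inj. Qed.

Lemma mx2E a b c d : (mx2 a b c d 0 0 = a) * (mx2 a b c d 0 1 = b) *
  (mx2 a b c d 1 0 = c) * (mx2 a b c d 1 1 = d).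
Proof. by rewrite !mxE. Qed.

Lemma mx2P M N : M 0 0 = N 0 0 -> M 0 1 = N 0 1 -> M 1 0 = N 1 0 ->
  M 1 1 = N 1 1 -> M = N.
Proof.
by move=> *; apply/matrixP => i j; case: (ord2P i) => ->; case: (ord2P j) => ->.
Qed.

Lemma mul_mx2 a b c d a' b' c' d' : mx2 a b c d *m mx2 a' b' c' d' =
  mx2 (a * a' + b * c') (a * b' + b * d') (c * a' + d * c') (c * b' + d * d').
Proof. by apply: mx2P; rewrite mxE sum2 !mx2E. Qed.

Lemma adj_mx2 a b c d : adj (mx2 a b c d) = mx2 a^* c^* b^* d^*.
Proof. by apply: mx2P; rewrite !mxE. Qed.

(** At the identity and the Pauli matrices these are the four Bell vectors, up to phase and the
    factor [sqrt 2]; hence [proj] and [overlap] there are twice the Bell projectors and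
    fidelities. *)
Definition vec M : 'cV[K]_(2 * 2) :=
  \col_k M (mxtens_unindex k).1 (mxtens_unindex k).2.

Definition proj M : 'M[K]_(2 * 2) := vec M *m adj (vec M).

Lemma vecE M i k : vec M (mxtens_index (i, k)) 0 = M i k.
Proof. by rewrite mxE mxtens_indexK. Qed.

Lemma projE M i k j l :
  proj M (mxtens_index (i, k)) (mxtens_index (j, l)) = M i k * (M j l)^*.
Proof. by rewrite mxE big_ord1 vecE !mxE mxtens_indexK. Qed.

(** Turns local operators on two qubits into products of 2 by 2 matrices; for [N] the conjugate of
    [M] it becomes conjugation by [M]. *)
Lemma tens_vec M N (P : 'M[K]_2) : (M *t N) *m vec P = vec (M *m P *m N^T).
Proof.
apply/matrixP => x y; rewrite [y]ord1; case: (mxtens_indexP x) => i k.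
rewrite vecE mxE sum_mxtens exchange_big mxE; apply: eq_bigr => l _.
rewrite mxE mulr_suml; apply: eq_bigr => j _.
by rewrite tensmxE vecE mxE mulrAC.
Qed.

Lemma adjM m n p (A : 'M[K]_(m, n)) (B : 'M[K]_(n, p)) :
  adj (A *m B) = adj B *m adj A.
Proof. by rewrite map_mxM trmx_mul. Qed.

Lemma proj_tens M N (P : 'M[K]_2) :
  (M *t N) *m proj P *m adj (M *t N) = proj (M *m P *m N^T).
Proof. by rewrite /proj -tens_vec adjM !mulmxA. Qed.

Lemma projZ c M : `|c| = 1 -> proj (c *: M) = proj M.
Proof.
move=> c1; apply/matrixP => x y; case: (mxtens_indexP x) => i k.
case: (mxtens_indexP y) => j l; rewrite !projE !mxE rmorphM /=.
by rewrite mulrACA -normCK c1 expr1n mul1r.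
Qed.

Definition pauliX := mx2 0 1 1 0.
Definition pauliZ := mx2 1 0 0 (-1).
(* Real up to the phase [-i], which [proj] does not see. *)
Definition pauliY := mx2 0 1 (-1) 0.
(* [(1 - i (X + Y + Z)) / 2], the rotation by 120 degrees about [(1, 1, 1)]. *)
Definition clifford := mx2 ((1 - 'i) / 2) (- (1 + 'i) / 2)
                           ((1 - 'i) / 2) ((1 + 'i) / 2).

Lemma addmxE m n (A B : 'M[K]_(m, n)) i j : (A + B) i j = A i j + B i j.
Proof. by rewrite mxE. Qed.

Definition overlap M sigma : K := (adj (vec M) *m sigma *m vec M) 0 0.

(** Completeness of the Bell basis; the factor 2 is the squared norm of its unnormalised vectors. *)
Lemma proj_pauli_sum :
  proj 1%:M + proj pauliX + proj pauliY + proj pauliZ = 2 *: 1%:M.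
Proof.
apply/matrixP => x y; case: (mxtens_indexP x) => i k.
case: (mxtens_indexP y) => j l; rewrite !addmxE !projE.
rewrite !mxE (can_eq (@mxtens_indexK _ _)).
by case: (ord2P i) => ->; case: (ord2P j) => ->; case: (ord2P k) => ->;
  case: (ord2P l) => -> /=; rewrite ?rmorphN ?rmorph1 ?rmorph0; ring.
Qed.

Lemma oppmxE m n (A : 'M[K]_(m, n)) i j : (- A) i j = - A i j.
Proof. by rewrite mxE. Qed.

Lemma scalemxE m n a (A : 'M[K]_(m, n)) i j : (a *: A) i j = a * A i j.
Proof. by rewrite mxE. Qed.

(** Over [R[i]], [sandwich (U *t V)] is convertible to [local_conj U V]. *)
Definition sandwich n (W sigma : 'M[K]_n) := W *m sigma *m adj W.

Lemma sandwichD n (W A B : 'M[K]_n) :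
  sandwich W (A + B) = sandwich W A + sandwich W B.
Proof. by rewrite /sandwich mulmxDr mulmxDl. Qed.

Lemma sandwichZ n (W A : 'M[K]_n) a :
  sandwich W (a *: A) = a *: sandwich W A.
Proof. by rewrite /sandwich -scalemxAr -scalemxAl. Qed.

Lemma overlapE M sigma : overlap M sigma = \tr (sigma *m proj M).
Proof.
by rewrite /proj mulmxA mxtrace_mulC mulmxA /overlap /mxtrace big_ord1.
Qed.

Lemma overlap_pauli_sum sigma : overlap 1%:M sigma + overlap pauliX sigma +
  overlap pauliY sigma + overlap pauliZ sigma = 2 * \tr sigma.
Proof.
by rewrite !overlapE -!mxtraceD -!mulmxDr proj_pauli_sum -scalemxAr mulmx1 mxtraceZ.
Qed.

Lemma overlap_entries M sigma : overlap M sigma = \sum_i \sum_k \sum_j \sum_l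
  (M i k)^* * sigma (mxtens_index (i, k)) (mxtens_index (j, l)) * M j l.
Proof.
rewrite /overlap -mulmxA mxE sum_mxtens; apply: eq_bigr => i _.
apply: eq_bigr => k _; rewrite [X in _ * X]mxE sum_mxtens mulr_sumr.
apply: eq_bigr => j _; rewrite mulr_sumr; apply: eq_bigr => l _.
by rewrite vecE !mxE mxtens_indexK mulrA.
Qed.

Lemma sandwich_tens_entries M N sigma i k j l :
  sandwich (M *t N) sigma (mxtens_index (i, k)) (mxtens_index (j, l)) =
  \sum_a \sum_b \sum_c \sum_d M i c * N k d *
    sigma (mxtens_index (c, d)) (mxtens_index (a, b)) * (M j a * N l b)^*.
Proof.
rewrite mxE sum_mxtens; apply: eq_bigr => a _; apply: eq_bigr => b _.
rewrite !mxE mulr_suml sum_mxtens; apply: eq_bigr => c _; apply: eq_bigr => d _.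
by rewrite tensmxE !mxtens_indexK.
Qed.

Lemma sum_pick (q : 'I_2) (F : 'I_2 -> K) : \sum_c (c == q)%:R * F c = F q.
Proof.
rewrite (bigD1 q) //= eqxx mul1r big1 ?addr0 // => c cq.
by rewrite (negPf cq) mul0r.
Qed.

Section Monomial.
Variables (P : 'M[K]_2) (s : 'I_2 -> K) (p : 'I_2 -> 'I_2).
Hypothesis PE : forall i c, P i c = s i * (c == p i)%:R.

(** Row [i] of [P] has the single entry [s i] in column [p i], so the fourfold sum collapses to one
    term. The identity and all Pauli matrices have this shape. *)
Lemma monomial_sandwich sigma i k j l :
  sandwich (P *t P) sigma (mxtens_index (i, k)) (mxtens_index (j, l)) =
  s i * s k * sigma (mxtens_index (p i, p k)) (mxtens_index (p j, p l)) *
  (s j * s l)^*.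
Proof.
rewrite sandwich_tens_entries.
transitivity (\sum_a (a == p j)%:R * \sum_b (b == p l)%:R *
   \sum_c (c == p i)%:R * \sum_d (d == p k)%:R * (s i * s k *
   sigma (mxtens_index (c, d)) (mxtens_index (a, b)) * (s j * s l)^*)).
  apply: eq_bigr => a _; rewrite mulr_sumr; apply: eq_bigr => b _.
  rewrite !mulr_sumr; apply: eq_bigr => c _.
  rewrite !mulr_sumr; apply: eq_bigr => d _.
  by rewrite !PE !rmorphM !rmorph_nat; ring.
by rewrite sum_pick sum_pick sum_pick sum_pick.
Qed.

Lemma monomial_overlap sigma : overlap P sigma = \sum_i \sum_j
  (s i)^* * sigma (mxtens_index (i, p i)) (mxtens_index (j, p j)) * s j.
Proof.
rewrite overlap_entries; apply: eq_bigr => i _.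
transitivity (\sum_k (k == p i)%:R * \sum_j \sum_l (l == p j)%:R *
  ((s i)^* * sigma (mxtens_index (i, k)) (mxtens_index (j, l)) * s j)).
  apply: eq_bigr => k _; rewrite mulr_sumr; apply: eq_bigr => j _.
  rewrite mulr_sumr; apply: eq_bigr => l _.
  by rewrite !PE !rmorphM !rmorph_nat; ring.
by rewrite sum_pick; apply: eq_bigr => j _; rewrite sum_pick.
Qed.

End Monomial.

(** The Bell vectors are joint eigenvectors of the four operators [P *t P], with distinct sign
    patterns, so the sum keeps only the Bell-diagonal part of [sigma]. The proof compares the
    entries. *)
Lemma pauli_twirl sigma :
  sandwich (1%:M *t 1%:M) sigma + sandwich (pauliX *t pauliX) sigma +
  sandwich (pauliY *t pauliY) sigma + sandwich (pauliZ *t pauliZ) sigma =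
  overlap 1%:M sigma *: proj 1%:M + overlap pauliX sigma *: proj pauliX +
  overlap pauliY sigma *: proj pauliY + overlap pauliZ sigma *: proj pauliZ.
Proof.
pose sgn (i : 'I_2) : K := if i == 0 then 1 else -1.
have E1 i c : (1%:M : 'M[K]_2) i c = 1 * (c == i)%:R.
  by rewrite mxE mul1r eq_sym.
(* In ['I_2], [1 - i] is the other index. *)
have EX i c : pauliX i c = 1 * (c == 1 - i)%:R.
  by case: (ord2P i) => ->; case: (ord2P c) => ->; rewrite mxE mul1r.
have EY i c : pauliY i c = sgn i * (c == 1 - i)%:R.
  by case: (ord2P i) => ->; case: (ord2P c) => ->; rewrite mxE /sgn /= ?mulr1 ?mulr0.
have EZ i c : pauliZ i c = sgn i * (c == i)%:R.
  by case: (ord2P i) => ->; case: (ord2P c) => ->; rewrite mxE /sgn /= ?mulr1 ?mulr0.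
have fl : ((1 - 0 : 'I_2) = 1) * ((1 - 1 : 'I_2) = 0) by split; apply: val_inj.
have sJ i : (sgn i)^* = sgn i.
  by rewrite /sgn; case: ifP => _; rewrite ?rmorphN rmorph1.
apply/matrixP => x y; case: (mxtens_indexP x) => i k.
case: (mxtens_indexP y) => j l.
rewrite !addmxE !scalemxE !projE.
rewrite (monomial_sandwich E1) (monomial_sandwich EX) (monomial_sandwich EY).
rewrite (monomial_sandwich EZ) (monomial_overlap E1) (monomial_overlap EX).
rewrite (monomial_overlap EY) (monomial_overlap EZ) !sum2 !rmorphM !sJ !rmorph1.
rewrite /sgn.
by case: (ord2P i) => ->; case: (ord2P j) => ->; case: (ord2P k) => ->;
  case: (ord2P l) => ->;
  rewrite !fl !mx2E ?mxE /= ?rmorphN ?rmorph1 ?rmorph0; ring.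
Qed.

(** Conjugation cycles the Pauli matrices; the phases appear because [pauliY] is ['i] times the
    Hermitian one. *)
Lemma clifford_mul : let C := clifford in
  [/\ C *m adj C = 1%:M, C *m pauliX *m adj C = - 'i *: pauliY,
      C *m pauliY *m adj C = 'i *: pauliZ & C *m pauliZ *m adj C = pauliX].
Proof.
rewrite /clifford /=.
have i2 : 'i * 'i = -1 :> K by rewrite -expr2 sqrCi.
rewrite !adj_mx2 !mul_mx2 !(rmorphM, rmorphN, rmorphB, rmorphD).
rewrite !(rmorph1, fmorphV, rmorph_nat) /= conjCi.
by split; apply: mx2P; rewrite ?mxE /=; field: i2.
Qed.

Lemma pauli_unitary : [/\ adj pauliX *m pauliX = 1%:M,
  adj pauliY *m pauliY = 1%:M & adj pauliZ *m pauliZ = 1%:M].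
Proof.
by split; rewrite adj_mx2 mul_mx2; apply: mx2P;
  rewrite !mxE /= ?rmorphN ?rmorph1 ?rmorph0; ring.
Qed.

(** The conjugate on the second factor makes [proj 1%:M] a fixed point. *)
Definition twirl_step (sigma : 'M[K]_(2 * 2)) :=
  sandwich (clifford *t map_mx Num.conj clifford) sigma.

Lemma twirl_step_proj (M N : 'M[K]_2) c : `|c| = 1 ->
  clifford *m M *m adj clifford = c *: N -> twirl_step (proj M) = proj N.
Proof. by move=> c1 e; rewrite /twirl_step /sandwich proj_tens e projZ. Qed.

(** Each step fixes the first Bell projector and cycles the other three, so these all end with the
    coefficient [b + c + d]; completeness rewrites their sum. *)
Lemma clifford_twirl (sigma : 'M[K]_(2 * 2)) (a b c d : K) :
  sigma = a *: proj 1%:M + b *: proj pauliX + c *: proj pauliY + d *: proj pauliZ ->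
  sigma + twirl_step sigma + twirl_step (twirl_step sigma) =
  (3 * a) *: proj 1%:M + (b + c + d) *: (2 *: 1%:M - proj 1%:M).
Proof.
have [C1 CX CY CZ] := clifford_mul.
have L1 : twirl_step (proj 1%:M) = proj 1%:M.
  by apply: (@twirl_step_proj _ _ 1); rewrite ?normr1// mulmx1 C1 scale1r.
have LX : twirl_step (proj pauliX) = proj pauliY.
  by apply: (twirl_step_proj _ CX); rewrite normrN normCi.
have LY : twirl_step (proj pauliY) = proj pauliZ.
  by apply: (twirl_step_proj _ CY); rewrite normCi.
have LZ : twirl_step (proj pauliZ) = proj pauliX.
  by apply: (@twirl_step_proj _ _ 1); rewrite ?normr1// CZ scale1r.
have LE s (a' b' c' d' : K) : s = a' *: proj 1%:M + b' *: proj pauliX +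
      c' *: proj pauliY + d' *: proj pauliZ ->
    twirl_step s = a' *: proj 1%:M + d' *: proj pauliX +
      b' *: proj pauliY + c' *: proj pauliZ.
  move=> ->; rewrite /twirl_step !sandwichD !sandwichZ -!/(twirl_step _).
  by rewrite L1 LX LY LZ -!addrA; congr (_ + _); rewrite addrA addrC.
move=> sE; have tE := LE _ _ _ _ _ sE; rewrite (LE _ _ _ _ _ tE) tE sE.
rewrite -proj_pauli_sum; apply/matrixP => x y.
rewrite !(addmxE, scalemxE, oppmxE); ring.
Qed.

Lemma full_twirl sigma : \tr sigma = 1 ->
  let s := sandwich (1%:M *t 1%:M) sigma + sandwich (pauliX *t pauliX) sigma +
    sandwich (pauliY *t pauliY) sigma + sandwich (pauliZ *t pauliZ) sigma in
  s + twirl_step s + twirl_step (twirl_step s) =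
  (3 * overlap 1%:M sigma) *: proj 1%:M +
  (2 - overlap 1%:M sigma) *: (2 *: 1%:M - proj 1%:M).
Proof.
move=> tr1 s; rewrite (clifford_twirl (pauli_twirl sigma)).
congr (_ + _ *: _); have := overlap_pauli_sum sigma; rewrite tr1 mulr1 => <-.
by ring.
Qed.

End QubitMatrices.

(** * Isotropic states and their decompositions *)

Section IsotropicStates.
Variable R : realType.
Local Notation C := R[i].
Local Notation fid sigma := ((dag (psi R) *m sigma *m psi R) 0 0).
Local Notation bell := (psi R *m dag (psi R)).

Lemma psi_vec : psi R = rC ((Num.sqrt 2)^-1) *: vec 1%:M.
Proof.
apply/matrixP => x y; rewrite [y]ord1; case: (mxtens_indexP x) => i k.
by rewrite scalemxE vecE psiE mxE mulrC.
Qed.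

Lemma bell_proj : bell = 2^-1 *: proj (1%:M : 'M[C]_2).
Proof.
by rewrite psi_vec dagZ conj_rC -scalemxAl -scalemxAr scalerA rC_sqrt2V.
Qed.

Lemma overlap_fid sigma : overlap 1%:M sigma = 2 * fid sigma.
Proof.
rewrite psi_vec dagZ conj_rC -scalemxAr -!scalemxAl scalerA rC_sqrt2V scalemxE.
by rewrite mulrA divff ?pnatr_eq0// mul1r.
Qed.

(** This isotropic matrix is the sum, of trace 12, of the twelve rotated copies of [sigma], each
    with maximal correlation at most [m]. *)
Lemma decomposable_twirl (m : R) (sigma : 'M[C]_(2 * 2)) :
  density sigma -> maxcorr sigma <= m ->
  decomposable m
    ((12 * fid sigma) *: bell + (4 * (1 - fid sigma)) *: (1%:M - bell)).
Proof.
move=> d le_m; have ds := decomposable_density d le_m.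
have [XU YU ZU] := pauli_unitary C; have [CU _ _ _] := clifford_mul C.
have step rho : decomposable m rho -> decomposable m (twirl_step rho).
  apply: decomposable_local_conj; first exact: mulmx1C.
  have -> : dag (map_mx Num.conj (clifford C)) *m map_mx Num.conj (clifford C) =
      map_mx Num.conj (dag (clifford C) *m clifford C).
    by rewrite map_mxM /dag matrix.map_trmx.
  by rewrite mulmx1C// map_mx1.
pose s := sandwich (1%:M *t 1%:M) sigma + sandwich (pauliX C *t pauliX C) sigma +
  sandwich (pauliY C *t pauliY C) sigma + sandwich (pauliZ C *t pauliZ C) sigma.
have TE : s + twirl_step s + twirl_step (twirl_step s) = _ := full_twirl d.2.
have dS : decomposable m s.
  have U1 : dag (1%:M : 'M[C]_2) *m 1%:M = 1%:M by rewrite dag1 mulmx1.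
  apply: decomposableD; last exact: (decomposable_local_conj ZU ZU ds).
  apply: decomposableD; last exact: (decomposable_local_conj YU YU ds).
  apply: decomposableD; last exact: (decomposable_local_conj XU XU ds).
  exact: (decomposable_local_conj U1 U1 ds).
have pE : proj 1%:M = 2 *: bell.
  by rewrite bell_proj scalerA divff ?pnatr_eq0// scale1r.
have -> : (12 * fid sigma) *: bell + (4 * (1 - fid sigma)) *: (1%:M - bell) =
    s + twirl_step s + twirl_step (twirl_step s).
  rewrite TE pE -scalerBr !scalerA overlap_fid; set f := fid sigma.
  by congr (_ *: _ + _ *: _); ring.
exact: (decomposableD (decomposableD dS (step _ dS)) (step _ (step _ dS))).
Qed.

Lemma fidD sigma tau : fid (sigma + tau) = fid sigma + fid tau.
Proof. by rewrite mulmxDr mulmxDl addmxE. Qed.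

Lemma fidZ c sigma : fid (c *: sigma) = c * fid sigma.
Proof. by rewrite -scalemxAr -scalemxAl scalemxE. Qed.

Lemma fid1 : fid 1%:M = 1.
Proof.
rewrite fidelityE !sum2 !mxE !(can_eq (@mxtens_indexK _ _)) /=.
by rewrite addr0 add0r mulVf// pnatr_eq0.
Qed.

Lemma mxtrace_bell : \tr bell = 1.
Proof. by rewrite mxtrace_mulC -fid1 mulmx1 /mxtrace big_ord1. Qed.

Lemma fid_bell : fid bell = 1.
Proof.
rewrite mulmxA -mulmxA [LHS]mxE big_ord1; have := fid1; rewrite mulmx1 => ->.
by rewrite mulr1.
Qed.

Definition maxmixed : 'M[C]_(2 * 2) := rC (1 / 4) *: 1%:M.

Lemma density_maxmixed : density maxmixed.
Proof.
split; first by apply: psdZ; [rewrite divr_ge0|exact: psd1].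
rewrite mxtraceZ mxtrace1 rmorphM fmorphV rmorph1 rmorph_nat mul1r.
by rewrite mulVf ?pnatr_eq0.
Qed.

Lemma maxcorr_maxmixed : maxcorr maxmixed = 0.
Proof.
have E : maxmixed = (2^-1 *: 1%:M) *t (2^-1 *: 1%:M).
  rewrite tensmxZl tensmxZr tensmx11 scalerA /maxmixed; congr (_ *: _).
  by rewrite rmorphM fmorphV rmorph1 rmorph_nat mul1r -invfM -natrM.
have [p _] := density_maxmixed; rewrite E in p *; apply: maxcorr_product => //.
by rewrite mxtraceZ mxtrace1 mulVf ?pnatr_eq0.
Qed.

Lemma density_rho_eps (eps : R) : 0 <= eps <= 1 -> density (rho_eps eps).
Proof.
move=> /andP[e0 e1]; split.
  apply: psdD; apply: psdZ; rewrite ?subr_ge0//; first exact: psd_outer.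
    by rewrite divr_ge0.
  exact: psd1.
rewrite mxtraceD !mxtraceZ mxtrace_bell mxtrace1 mulr1 -(rmorph_nat (@rC R)).
by rewrite -rmorphM -rmorphD divfK ?pnatr_eq0// subrK rmorph1.
Qed.

(** Origin of the threshold in [lambda]: [bell] contributes [1 - eps] and the noise [eps / 4]. *)
Lemma fid_rho_eps (eps : R) : fid (rho_eps eps) = rC (1 - 3 * eps / 4).
Proof.
rewrite fidD; transitivity (rC (1 - eps) + rC (eps / 4)).
  by congr (_ + _); rewrite fidZ ?fid_bell ?fid1 mulr1.
by rewrite -rmorphD; congr rC; field.
Qed.

(** [rho_eps] lies between the twirled [sigma], whose fidelity [f] is at least as large, and
    [maxmixed], of fidelity 1/4. The weight [s] of the former equates the fidelities:
    [s * f + (1 - s) / 4 = 1 - 3 * eps / 4]. *)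
Lemma decomposable_rho_eps (eps m : R) (sigma : 'M[C]_(2 * 2)) :
  0 <= eps <= 1 -> 0 <= m -> density sigma -> maxcorr sigma <= m ->
  rC (1 - 3 * eps / 4) <= fid sigma -> decomposable m (rho_eps eps).
Proof.
move=> /andP[e0 e1] m0 d le_m le_f.
have := decomposable_twirl d le_m.
rewrite -(ReK (d.1 _)); set f := complex.Re _; move: le_f.
rewrite -(ReK (d.1 _)) -/f ler_rC => le_f dT.
have dI : decomposable m maxmixed.
  by apply: (decomposable_density density_maxmixed); rewrite maxcorr_maxmixed.
(* If [f = 1 / 4], then [eps = 1], and [s = 0] thanks to [x / 0 = 0]. *)
pose s := 3 * (1 - eps) / (4 * f - 1).
have sE : s * (4 * f - 1) = 3 * (1 - eps).
  rewrite /s; have [f4|] := eqVneq (4 * f - 1) 0; last by move=> ?; rewrite divfK.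
  by rewrite f4 mulr0; lra.
have s0 : 0 <= s by rewrite divr_ge0//; lra.
have s1 : s <= 1.
  have [f4|f4] := eqVneq (4 * f - 1) 0; first by rewrite /s f4 invr0 mulr0.
  by rewrite ler_pdivrMr ?mul1r; lra.
have -> : rho_eps eps = rC (s / 12) *: ((12 * rC f) *: bell +
    (4 * (1 - rC f)) *: (1%:M - bell)) + rC (1 - s) *: maxmixed.
  (* [e12] and [e4] match the coefficients of [bell] and of the identity. *)
  have e12 : s / 12 * (12 * f) - s / 12 * (4 * (1 - f)) = 1 - eps.
    by transitivity (s * (4 * f - 1) / 3); [field | rewrite sE; field].
  have e4 : s / 12 * (4 * (1 - f)) + (1 - s) * (1 / 4) = eps / 4.
    transitivity (1 / 4 - s * (4 * f - 1) / 12); first by field.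
    by rewrite sE; field.
  rewrite /rho_eps /maxmixed -e12 -e4 -[1 - rC f](_ : rC (1 - f) = _); last first.
    by rewrite rmorphB rmorph1.
  rewrite -!(rmorph_nat (@rC R)) -!rmorphM scalerDr !scalerA -!rmorphM.
  rewrite rmorphB rmorphD scalerBl scalerDl scalerBr !addrA.
  by congr (_ + _); rewrite addrAC.
apply: decomposableD; first by apply: decomposableZ => //; rewrite divr_ge0.
by apply: decomposableZ => //; rewrite subr_ge0.
Qed.

End IsotropicStates.

(** * Correlation of the isotropic state and fidelities in its decompositions *)

Section Bounds.
Variable R : realType.
Local Notation C := R[i].
Local Notation fid sigma := ((dag (psi R) *m sigma *m psi R) 0 0).

Lemma rho_epsE (eps : R) i j k l :
  rho_eps eps (mxtens_index (i, k)) (mxtens_index (j, l)) =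
  rC ((1 - eps) / 2 * ((i == k) && (j == l))%:R +
      eps / 4 * ((i == j) && (k == l))%:R).
Proof.
have e2 : 2^-1 = rC 2^-1 :> C by rewrite fmorphV rmorph_nat.
rewrite /rho_eps bell_proj addmxE !scalemxE projE !mxE rmorph_nat -natrM mulnb.
rewrite (can_eq (@mxtens_indexK _ _)) xpair_eqE e2 -!(rmorph_nat (@rC R)).
by rewrite -!rmorphM -rmorphD mulrA.
Qed.

Lemma ptraceB_rho_eps (eps : R) : ptraceB (rho_eps eps) = rC (1 / 2) *: 1%:M.
Proof.
apply/matrixP => i j; rewrite mxE sum2 !rho_epsE scalemxE mxE -(rmorph_nat (@rC R)).
rewrite -rmorphD -rmorphM; congr rC.
by case: (ord2P i) => ->; case: (ord2P j) => -> /=; field.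
Qed.

Lemma ptraceA_rho_eps (eps : R) : ptraceA (rho_eps eps) = rC (1 / 2) *: 1%:M.
Proof.
apply/matrixP => i j; rewrite mxE sum2 !rho_epsE scalemxE mxE -(rmorph_nat (@rC R)).
rewrite -rmorphD -rmorphM; congr rC.
by case: (ord2P i) => ->; case: (ord2P j) => -> /=; field.
Qed.

(** The reduced states do not depend on [eps], so an admissible pair is normalised for [rho_eps 0]
    too, where its correlation is at most 1. The noise contributes nothing, as [X] is traceless, and
    the factor [1 - eps] remains. *)
Lemma maxcorr_rho_eps_le (eps : R) : 0 <= eps <= 1 ->
  maxcorr (rho_eps eps) <= 1 - eps.
Proof.
move=> /andP[e0 e1]; apply: maxcorr_le; first by rewrite subr_ge0.
have hspD M N : hsp (rho_eps eps) M N =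
    rC (1 - eps) * hsp (rho_eps 0) M N + rC (eps / 4) * hsp 1%:M M N.
  rewrite /rho_eps /hsp mul0r subr0 rmorph0 scale0r addr0 rmorph1 scale1r.
  by rewrite mulmxDl mxtraceD -!scalemxAl !mxtraceZ.
have hspA X X' : hsp (rho_eps eps) (X *t 1%:M) (X' *t 1%:M) =
    hsp (rho_eps 0) (X *t 1%:M) (X' *t 1%:M).
  by rewrite !hsp_lA !ptraceB_rho_eps.
have hspB Y Y' : hsp (rho_eps eps) (1%:M *t Y) (1%:M *t Y') =
    hsp (rho_eps 0) (1%:M *t Y) (1%:M *t Y').
  by rewrite !hsp_lB !ptraceA_rho_eps.
move=> X Y hX _; rewrite hspA hspB => vX vY.
have trX : \tr X = 0.
  move: hX; rewrite hsp_lA1 ptraceB_rho_eps -scalemxAl mul1mx mxtraceZ.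
  move/eqP; rewrite mulf_eq0 => /orP[|/eqP//].
  by rewrite -(rmorph0 (@rC R)) (inj_eq (@rC_inj R)) mulf_eq0 invr_eq0 oner_eq0
    pnatr_eq0.
rewrite hspD -[hsp 1%:M _ _]hsp_tens mul1mx mxtrace_tens trX mul0r mulr0 addr0.
have p0 : psd (rho_eps (0 : R)).
  by have [] := @density_rho_eps R 0; rewrite // lexx ler01.
have := hsp_CauchySchwarz p0 (X *t 1%:M) (1%:M *t Y).
rewrite vX vY mulr1 expr_le1// => le1.
rewrite cabs_le normrM ger0_norm ?rC_ge0 ?subr_ge0//.
by rewrite -[X in _ <= X]mulr1 ler_wpM2l// rC_ge0 subr_ge0.
Qed.

(** The fidelities average to [c] with weights summing to 1. Were all of them below [c], the
    nonnegative terms [p i * (c - f i)], of sum 0, would force every weight to vanish. *)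
Lemma fid_exists n (p : 'I_n -> R) (tau : 'I_n -> 'M[C]_(2 * 2)) (eps : R) :
  (forall i, 0 <= p i) -> (forall i, density (tau i)) ->
  rho_eps eps = \sum_i rC (p i) *: tau i -> 0 <= eps <= 1 ->
  exists i, rC (1 - 3 * eps / 4) <= fid (tau i).
Proof.
move=> p0 d rhoE e01; set c := 1 - _.
pose f i := complex.Re (fid (tau i)).
have fE i : fid (tau i) = rC (f i) by rewrite ReK//; case: (d i).
have sump : \sum_i p i = 1.
  apply: (@rC_inj R); rewrite rmorph_sum rmorph1 -(density_rho_eps e01).2 rhoE.
  rewrite raddf_sum; apply: eq_bigr => i _.
  by rewrite /= mxtraceZ (d i).2 mulr1.
have sumf : \sum_i p i * f i = c.
  apply: (@rC_inj R); rewrite rmorph_sum -fid_rho_eps rhoE.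
  rewrite mulmx_sumr mulmx_suml summxE; apply: eq_bigr => i _.
  by rewrite fidZ fE rmorphM.
have [/existsP[i le_f]|] := boolP [exists i, c <= f i].
  by exists i; rewrite fE ler_rC.
rewrite negb_exists => /forallP lt_f.
have lt_f' i : f i < c by rewrite ltNge lt_f.
have : \sum_i p i * (c - f i) = 0.
  under eq_bigr do rewrite mulrBr; rewrite sumrB sumf -mulr_suml sump mul1r.
  exact: subrr.
move/eqP; rewrite psumr_eq0 => [/allP pz|i _]; last first.
  by rewrite mulr_ge0// subr_ge0 ltW.
have : \sum_i p i = 0.
  apply: big1 => i _; have /= := pz i (mem_index_enum i).
  by rewrite mulf_eq0 subr_eq0 (gt_eqF (lt_f' i)) orbF => /eqP.
by rewrite sump => /eqP; rewrite oner_eq0.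
Qed.

End Bounds.

(** * The equality and the bounds on [lambda] *)

Theorem theorem8 (R : realType) (eps : R) :
  0 <= eps -> eps <= 1 ->
  [/\ maxent (rho_eps eps) = lambda eps,
      2 / 3 <= eps -> lambda eps = 0 &
      eps < 2 / 3 -> 1 - 3 * eps / 2 <= lambda eps /\ lambda eps <= 1 - eps].
Proof.
move=> e0 e1; have e01 : 0 <= eps <= 1 by rewrite e0.
have fid_rho : rC (1 - 3 * eps / 4) <= (dag (psi R) *m rho_eps eps *m psi R) 0 0.
  by rewrite fid_rho_eps.
have d_rho := density_rho_eps e01.
have lambda_le sigma : density sigma ->
    rC (1 - 3 * eps / 4) <= (dag (psi R) *m sigma *m psi R) 0 0 ->
    lambda eps <= maxcorr sigma.
  move=> d f; apply: ge_inf; last by exists sigma.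
  by exists 0 => r [tau [[p _] _ ->]]; exact: maxcorr_ge0.
have le_lambda m : (forall sigma, density sigma ->
    rC (1 - 3 * eps / 4) <= (dag (psi R) *m sigma *m psi R) 0 0 ->
    m <= maxcorr sigma) -> m <= lambda eps.
  (* [rho_eps] meets the fidelity constraint with equality, so the infimum is over a nonempty
     set. *)
  move=> le_m; apply: lb_le_inf;
    first by exists (maxcorr (rho_eps eps)), (rho_eps eps).
  by move=> r [tau [d f ->]]; exact: le_m.
split.
- apply: le_anti; apply/andP; split.
    (* Each [sigma] admissible in [lambda] yields a decomposition of [rho_eps] into states no more
       correlated than [sigma]. *)
    apply: le_lambda => sigma d f; apply: maxent_le; first exact: maxcorr_ge0 d.1.
    exact: decomposable_rho_eps (maxcorr_ge0 d.1) d (lexx _) f.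
  apply: lb_le_inf.
    by eexists; exists 1%N, (fun=> 1), (fun=> rho_eps eps); split => //;
      rewrite big_ord1 rmorph1 scale1r.
  move=> r [n [p [tau [p0 d rhoE ->]]]].
  (* This term is itself admissible in [lambda]. *)
  have [i f] := fid_exists p0 d rhoE e01.
  by apply: le_trans (lambda_le _ (d i) f) _; exact: le_bigmax.
- move=> e23; apply: le_anti; apply/andP; split; last first.
    by apply: le_lambda => sigma d _; exact: maxcorr_ge0 d.1.
  (* The product state [|00><00|] has fidelity 1/2, which reaches the threshold exactly when
     [2 / 3 <= eps]. *)
  pose z : 'M[R[i]]_2 := delta_mx 0 0.
  have zE : z *t z = delta_mx (mxtens_index (0, 0)) 0 *m
      dag (delta_mx (mxtens_index (0, 0)) 0 : 'cV_(2 * 2)).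
    by rewrite tensmx_delta dag_delta mul_delta_mx.
  have psdz : psd (z *t z) by rewrite zE; exact: psd_outer.
  have trz : \tr z = 1 by rewrite /mxtrace sum2 !mxE /= addr0.
  rewrite -(maxcorr_product psdz trz); apply: lambda_le.
    by split; rewrite // mxtrace_tens trz mulr1.
  rewrite fidelityE !sum2 !tensmxE !mxE /= !mulr0 !mulr1 !addr0 mulr1.
  rewrite -(rmorph_nat (@rC R)) -fmorphV ler_rC; lra.
- move=> _; split.
    (* At the threshold fidelity, [2 * f - 1] equals [1 - 3 * eps / 2]. *)
    apply: le_lambda => sigma d /(maxcorr_ge_fidelity d); apply: le_trans; lra.
  by apply: le_trans (maxcorr_rho_eps_le e01); exact: lambda_le.
Qed.
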